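(* Let $M>m>0$ be real numbers, let $\mathcal{H}$ be a complex Hilbert space and let $A\in\mathcal{B}(\mathcal{H})$. (i) If $C_{M,m}(|A|)$ is accretive, then $\mathfrak{R}A\le \frac{M+m}{2\sqrt{Mm}}\,|A|$. (ii) If $C_{M,m}(|\mathrm{i}A^*|)$ is accretive, then $\mathfrak{I}A\le \frac{M+m}{2\sqrt{Mm}}\,|A^*|$. (iii) If $A$ is invertible and $C_{M,m}(|A^{-1}|)$ is accretive, then $\mathfrak{R}A^{-1}\le \frac{M+m}{2\sqrt{Mm}}\,|A^{-1}|$.
   Context: $\mathcal{B}(\mathcal{H})$ is the algebra of bounded linear operators on $\mathcal{H}$, with identity $I$. $C_{M,m}(T)=(MI-T^* )(T-mI)$; $|T|=(T^*T)^{1/2}$; $\mathfrak{R}T=\frac{T+T^*}{2}$ and $\mathfrak{I}T=\frac{T-T^*}{2\mathrm{i}}$. $T$ is accretive if $\mathfrak{R}T\ge 0$ (positive semi-definite). For self-adjoint $S,T$, $S\le T$ means $T-S$ is positive semi-definite. *)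

(* Defs.v *)
From HB Require Import structures.
From mathcomp Require Import all_boot all_order all_algebra.
From mathcomp Require Import all_classical all_reals all_analysis.
From mathcomp Require Import complex.

Set Implicit Arguments.
Unset Strict Implicit.
Unset Printing Implicit Defensive.

Import Order.TTheory GRing.Theory Num.Theory.
Local Open Scope ring_scope.
Local Open Scope complex_scope.

(* A complex Hilbert space is a complete normed R[i]-module whose norm comes   *)
(* from an inner product, linear on the left and conjugate-linear on the       *)
(* right. The zero space is allowed and no separability is assumed.            *)
HB.mixin Record CompleteNormedModule_isHilbert (R : realType) H
    & CompleteNormedModule R[i] H := {
  hdot : {dot H for Num.conj};
  normr_hdot : forall x : H, `|x| ^+ 2 = hdot x x
}.

#[short(type="hilbertType")]
HB.structure Definition Hilbert (R : realType) :=
  {H of CompleteNormedModule R[i] H & CompleteNormedModule_isHilbert R H}.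

Section BoundedOperators.
Variables (R : realType) (H : hilbertType R).

Definition bounded_linear (f : H -> H) :=
  linear f /\ exists C : R[i], forall x, `|f x| <= C * `|x|.

Definition bop_pred : {pred H -> H} := [pred f | `[< bounded_linear f >]].

Record bop := BOp { bop_fun :> H -> H; _ : bop_fun \in bop_pred }.

HB.instance Definition _ := [isSub for bop_fun].
HB.instance Definition _ := [Choice of bop by <:].

Lemma bopP (A : bop) : bounded_linear A.
Proof. by case: A => f /= /asboolP. Qed.

Lemma bop_ext (A B : bop) : (forall x, A x = B x) -> A = B.
Proof. by move=> AB; apply/val_inj/funext. Qed.

HB.instance Definition _ (A : bop) :=
  GRing.isLinear.Build R[i] H H *:%R A (proj1 (bopP A)).

Lemma bop_bounded (A : bop) :
  exists2 C : R[i], 0 <= C & forall x, `|A x| <= C * `|x|.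
Proof.
have [_ [C AC]] := bopP A.
have [H0|/existsNP[x /eqP x0]] := pselect (forall x : H, x = 0).
  by exists 0 => // x; rewrite (H0 x) linear0 !normr0 mulr0.
exists C => //; have := le_trans (normr_ge0 _) (AC x).
by rewrite pmulr_lge0// normr_gt0.
Qed.

Lemma bop_submod_closed : submod_closed bop_pred.
Proof.
split=> [|a f g].
  apply/asboolP; split; first by move=> a x y; rewrite /= scaler0 addr0.
  by exists 0 => x; rewrite normr0 mul0r.
move=> fP gP; pose F := BOp fP; pose G := BOp gP.
have [[C _ fC] [D _ gD]] := (bop_bounded F, bop_bounded G).
apply/asboolP; split=> [b x y|].
  change (a *: F (b *: x + y) + G (b *: x + y) =
    b *: (a *: F x + G x) + (a *: F y + G y)).
  by rewrite (linearP F) (linearP G) !scalerDr !scalerA [b * a]mulrC addrACA.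
exists (`|a| * C + D) => x; apply: le_trans (ler_normD _ _) _.
rewrite mulrDl lerD//.
by rewrite [leLHS]normrZ -mulrA ler_wpM2l//; exact: fC.
Qed.

HB.instance Definition _ := GRing.isSubmodClosed.Build _ _ bop_pred
  bop_submod_closed.
HB.instance Definition _ := [SubChoice_isSubLmodule of bop by <:].

Lemma bop_one_subproof : (@idfun H) \in bop_pred.
Proof. by apply/asboolP; split=> //; exists 1 => x; rewrite mul1r. Qed.

Lemma bop_mul_subproof (A B : bop) : (A \o B) \in bop_pred.
Proof.
apply/asboolP; split=> [a x y|]; first by rewrite /= !linearP.
have [[C C0 AC] [D _ BD]] := (bop_bounded A, bop_bounded B).
exists (C * D) => x; apply: le_trans (AC _) _.
by rewrite -mulrA ler_wpM2l.
Qed.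

Definition bop_one := BOp bop_one_subproof.
Definition bop_mul (A B : bop) := BOp (bop_mul_subproof A B).

Fact bop_mulA : associative bop_mul.
Proof. by move=> A B C; exact: bop_ext. Qed.

Fact bop_mul1r : left_id bop_one bop_mul.
Proof. by move=> A; exact: bop_ext. Qed.

Fact bop_mulr1 : right_id bop_one bop_mul.
Proof. by move=> A; exact: bop_ext. Qed.

Fact bop_mulDl : left_distributive bop_mul +%R.
Proof. by move=> A B C; exact: bop_ext. Qed.

Fact bop_mulDr : right_distributive bop_mul +%R.
Proof. by move=> A B C; apply: bop_ext => x; exact: (linearD A). Qed.

(* B(H) is the zero ring when H = 0, hence pzRing and not nzRing. *)
HB.instance Definition _ := GRing.Zmodule_isPzRing.Build bop
  bop_mulA bop_mul1r bop_mulr1 bop_mulDl bop_mulDr.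

(* The adjoint, the inverse and the modulus are characterized uniquely by      *)
(* their defining property among bounded operators; xget only returns its      *)
(* default 0 when inverting an operator that is not invertible in B(H).        *)
Definition adjop (A : bop) : bop :=
  xget 0 [set B : bop | forall x y : H, hdot (A x) y = hdot x (B y)].

Definition invertible_op (A : bop) := exists B : bop, A * B = 1 /\ B * A = 1.

Definition invop (A : bop) : bop :=
  xget 0 [set B : bop | A * B = 1 /\ B * A = 1].

(* In the order of R[i], 0 <= z says that z is real and nonnegative, so a      *)
(* positive operator is self-adjoint (the scalars being complex).              *)
Definition posop (A : bop) := forall x : H, 0 <= hdot (A x) x.

Definition ople (A B : bop) := posop (B - A).

Definition absop (A : bop) : bop :=
  xget 0 [set P : bop | posop P /\ P * P = adjop A * A].

Definition reop (A : bop) : bop := (2%:R^-1 : R[i]) *: (A + adjop A).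

Definition imop (A : bop) : bop := ((2%:R * 'i)^-1 : R[i]) *: (A - adjop A).

Definition accretive (A : bop) := posop (reop A).

Definition Cop (M m : R) (A : bop) : bop :=
  (M%:C *: (1 : bop) - adjop A) * (A - m%:C *: (1 : bop)).

End BoundedOperators.

(* Main.v *)
Require Import Defs.
From mathcomp Require Import all_boot all_order all_algebra.
From mathcomp Require Import all_classical all_reals all_analysis.
From mathcomp Require Import complex ring.

(** Put [P = |B|] and [s = sqrt (M m)].  Since [P] is self-adjoint, so is
    [(M - P)(P - m)], and its accretivity says, for every [x],
      [|P x|^2 + M m |x|^2 <= (M + m) <P x, x>]   ([accretive_Cop]).
    As [|P x| = |B x|], expanding [0 <= |B x - s x|^2] gives
      [2 s Re <B x, x> <= |B x|^2 + M m |x|^2 <= (M + m) <P x, x>],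
    that is, [Re B <= (M + m) / (2 s) |B|] ([reop_le_absop]).  Parts (i) and
    (iii) are this inequality for [B = A] and [B = A^-1].  For part (ii) take
    [B = i A^*]: its real part is [Im A] ([imop_reop]) and its modulus is
    [|A^*|] ([absop_unimodular]).

    [adjop] and [absop] are choices with default value [0].  If the default
    were taken by [adjop B] or by [absop B], then [|B|^2] would vanish; but the
    displayed inequality makes [P] injective, so this happens only in the zero
    space, where every operator is positive ([accretive_absopP]).  In part (ii)
    the default for [adjop A] makes [B = 0], with the same effect. *)

Import Order.TTheory GRing.Theory Num.Theory.

Local Open Scope ring_scope.

Section Modulus.

Set Implicit Arguments.
Unset Strict Implicit.

Variables (R : realType) (H : hilbertType R).
Implicit Types (A B P : bop H) (x y z : H) (a : R[i]) (M m : R).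

(** * The inner product *)

Lemma hdotDl x y z : hdot (x + y) z = hdot x z + hdot y z.
Proof. by rewrite linearDl. Qed.

Lemma hdotDr x y z : hdot x (y + z) = hdot x y + hdot x z.
Proof. by rewrite linearDr. Qed.

Lemma hdotZl a x y : hdot (a *: x) y = a * hdot x y.
Proof. by rewrite linearZl_LR. Qed.

Lemma hdotZr a x y : hdot x (a *: y) = a^* * hdot x y.
Proof. by rewrite linearZr_LR. Qed.

Lemma hdotNl x y : hdot (- x) y = - hdot x y.
Proof. by rewrite linearNl. Qed.

Lemma hdotNr x y : hdot x (- y) = - hdot x y.
Proof. by rewrite linearNr. Qed.

Definition hdotE := (hdotDl, hdotDr, hdotNl, hdotNr, hdotZl, hdotZr).

Lemma hdot_conj x y : (hdot x y)^* = hdot y x.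
Proof. by rewrite [RHS]hermC expr0 mul1r. Qed.

Lemma hdot_ge0 x : 0 <= hdot x x.
Proof. by rewrite -normr_hdot exprn_ge0. Qed.

Lemma hdot_eq0 x : hdot x x = 0 -> x = 0.
Proof. by move=> /eqP; rewrite -normr_hdot expf_eq0 normr_eq0 => /eqP. Qed.

(** * Adjoints *)

Definition is_adjoint A B := forall x y, hdot (A x) y = hdot x (B y).

Lemma is_adjoint_sym A B : is_adjoint A B -> is_adjoint B A.
Proof. by move=> AB x y; rewrite -hdot_conj -AB hdot_conj. Qed.

Lemma is_adjointZ a A B : is_adjoint A B -> is_adjoint (a *: A) (a^* *: B).
Proof. by move=> AB x y; rewrite hdotZl hdotZr conjCK AB. Qed.

Lemma is_adjointB A A' B B' :
  is_adjoint A A' -> is_adjoint B B' -> is_adjoint (A - B) (A' - B').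
Proof.
move=> AA BB x y; rewrite [LHS]hdotDl [RHS]hdotDr.
by rewrite [hdot _ y in X in _ + X]hdotNl [X in _ = _ + X]hdotNr AA BB.
Qed.

Lemma is_adjointM A A' B B' :
  is_adjoint A A' -> is_adjoint B B' -> is_adjoint (A * B) (B' * A').
Proof. by move=> AA BB x y; rewrite [LHS]AA BB. Qed.

Lemma is_adjoint_inj A B B' : is_adjoint A B -> is_adjoint A B' -> B = B'.
Proof.
move=> AB AB'; apply: bop_ext => y; apply/eqP; rewrite -subr_eq0; apply/eqP.
by apply: hdot_eq0; rewrite [X in X = _]hdotDr hdotNr -AB -AB' subrr.
Qed.

Lemma adjop_adjoint A B : is_adjoint A B -> adjop A = B.
Proof.
move=> AB; rewrite /adjop; case: xgetP => [B' _ AB'|/(_ B)]; last by case.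
exact: is_adjoint_inj AB' AB.
Qed.

Lemma adjopP A : is_adjoint A (adjop A) \/ adjop A = 0.
Proof. by rewrite /adjop; case: xgetP => [B ->|]; [left|right]. Qed.

Lemma absopP A :
  (posop (absop A) /\ absop A * absop A = adjop A * A) \/ absop A = 0.
Proof. by rewrite /absop; case: xgetP => [P ->|]; [left|right]. Qed.

Lemma posop0 : posop (0 : bop H).
Proof. by move=> x; rewrite [X in _ <= X](linear0l hdot). Qed.

(** Polarization: the quadratic form at [a x + y] is real, hence so is its cross
    term [a <P x, y> + a^* <P y, x>]; the cases [a = 1] and [a = i] together say
    that [<P x, y>] and [<P y, x>] are conjugate. *)
Lemma posop_adjoint P : posop P -> is_adjoint P P.
Proof.
move=> P0 x y.
have cross_real a : a * hdot (P x) y + a^* * hdot (P y) x \is Num.real.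
  have := ger0_real (P0 (a *: x + y)); rewrite (linearP P) !hdotE => Preal.
  have aPx : a * (a^* * hdot (P x) x) \is Num.real.
    by rewrite mulrA -normCK ger0_real// mulr_ge0// exprn_ge0.
  have := rpredB (rpredB Preal aPx) (ger0_real (P0 y)).
  by congr (is_true (in_mem _ _)); ring.
have /CrealP := cross_real 1; have /CrealP := cross_real 'i.
rewrite !rmorphD !rmorphM /= !conjCK !conjCi rmorph1 !mul1r.
rewrite -(hdot_conj (P y) x); set b := hdot (P x) y; set c := hdot (P y) x.
move=> eq_i eq_1.
have eq_i' : c^* - b^* = b - c.
  apply: (mulfI (neq0Ci _)); rewrite !mulrBr.
  by rewrite !mulNr addrC in eq_i.
apply: (@mulfI _ (2%:R : R[i])); first by rewrite pnatr_eq0.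
transitivity ((b + c) + (b - c)); first by ring.
by rewrite -eq_1 -eq_i'; ring.
Qed.

Lemma hdot_reop A x : is_adjoint A (adjop A) ->
  hdot (reop A x) x = 2%:R^-1 * (hdot (A x) x + (hdot (A x) x)^*).
Proof.
move=> AA; rewrite [hdot (A x) x in X in _ * (_ + X)]AA.
by rewrite hdot_conj [LHS]hdotZl [X in _ * X]hdotDl.
Qed.

(** * Accretivity of the quadratic transform *)

Lemma conjC_real (r : R) : (r%:C%C)^* = r%:C%C.
Proof. by rewrite conj_Creal // complex_real. Qed.

(** [Cop M m P] is self-adjoint because its two factors are self-adjoint and
    commute, so it equals its real part, and its quadratic form is the
    difference of the two sides. *)
Lemma accretive_Cop M m P : posop P -> accretive (Cop M m P) ->
  forall x, hdot (P x) (P x) + (M * m)%:C%C * hdot x x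
    <= (M + m)%:C%C * hdot (P x) x.
Proof.
move=> P0 accP x; have PP := posop_adjoint P0.
have scalarP (r : R) : is_adjoint (r%:C%C *: (1 : bop H)) (r%:C%C *: (1 : bop H)).
  by rewrite -[X in _ (X *: _)]conjC_real; apply: is_adjointZ.
have CE : hdot (Cop M m P x) x = (M + m)%:C%C * hdot (P x) x -
    (hdot (P x) (P x) + (M * m)%:C%C * hdot x x).
  rewrite /Cop (adjop_adjoint PP).
  rewrite [LHS](is_adjointB (scalarP M) PP).
  rewrite [LHS](_ : _ = hdot (P x - m%:C%C *: x) (M%:C%C *: x - P x)) //.
  by rewrite !hdotE conjC_real -(PP x x) rmorphD rmorphM /=; ring.
have Cadj : is_adjoint (Cop M m P) (adjop (Cop M m P)).
  have CC : is_adjoint (Cop M m P)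
      ((P - m%:C%C *: (1 : bop H)) * (M%:C%C *: (1 : bop H) - P)).
    by rewrite /Cop (adjop_adjoint PP); apply: is_adjointM; exact: is_adjointB.
  by rewrite (adjop_adjoint CC).
have Creal : (hdot (Cop M m P x) x)^* = hdot (Cop M m P x) x.
  rewrite CE (rmorphB Num.conj) (rmorphD Num.conj) !(rmorphM Num.conj) /=.
  by rewrite !conjC_real !hdot_conj -(PP x x).
have := accP x; rewrite hdot_reop// Creal CE.
by rewrite -mulr2n -(mulr_natl (_ - _)) mulKf ?pnatr_eq0// subr_ge0.
Qed.

Lemma accretive_Cop_inj M m P x : 0 < M * m -> posop P ->
  accretive (Cop M m P) -> P x = 0 -> x = 0.
Proof.
move=> Mm0 P0 accP Px; apply: hdot_eq0.
apply/eqP; rewrite eq_le hdot_ge0 andbT.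
have := accretive_Cop P0 accP x.
by rewrite Px !(linear0l hdot) add0r mulr0 pmulr_rle0 // ltcR.
Qed.

(** Outside the zero space, accretivity rules out the default values of [absop]
    and [adjop], because each of them forces [absop B] to vanish. *)
Lemma accretive_absopP M m B : 0 < M * m -> accretive (Cop M m (absop B)) ->
  (forall x, x = 0) \/ [/\ posop (absop B),
    forall x, hdot (absop B x) (absop B x) = hdot (B x) (B x)
    & is_adjoint B (adjop B)].
Proof.
move=> Mm0 accB; have [[P0 PP]|abs0] := absopP B; last first.
  left=> x; apply: accretive_Cop_inj Mm0 _ accB _; rewrite abs0 //.
  exact: posop0.
have normP x : hdot (absop B x) (absop B x) = hdot x (adjop B (B x)).
  by rewrite (posop_adjoint P0) -[adjop B (B x)]/((adjop B * B) x) -PP.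
have [BB|adj0] := adjopP B; [right|left=> x].
  by split=> // x; rewrite normP BB.
apply: accretive_Cop_inj Mm0 P0 accB _; apply: hdot_eq0.
by rewrite normP adj0 [LHS]linear0r.
Qed.

(** * Real and imaginary parts *)

(** The bound [0 <= |B x - s x|^2] with [s = sqrt (M m)] replaces the
    Cauchy-Schwarz and arithmetic-geometric mean inequalities: this [s] turns
    [s^2 |x|^2] into the term [M m |x|^2] of [accretive_Cop]. *)
Lemma re_hdot_le M m B P x : 0 < M * m -> posop P ->
  accretive (Cop M m P) -> hdot (P x) (P x) = hdot (B x) (B x) ->
  2%:R^-1 * (hdot (B x) x + (hdot (B x) x)^*) <=
    ((M + m) / (2%:R * Num.sqrt (M * m)))%:C%C * hdot (P x) x.
Proof.
move=> Mm0 P0 accP normP.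
have s0 : 0 < (Num.sqrt (M * m))%:C%C :> R[i] by rewrite ltcR sqrtr_gt0.
set s := (Num.sqrt _)%:C%C in s0.
have sE : s ^+ 2 = (M * m)%:C%C by rewrite /s -rmorphXn /= sqr_sqrtr ?ltW.
have [s_neq0 s_conj] : s != 0 /\ s^* = s by rewrite conjC_real gt_eqF.
have := accretive_Cop P0 accP x; rewrite normP -sE => le_cop.
have le_sqr : s * (hdot (B x) x + (hdot (B x) x)^*) <=
    hdot (B x) (B x) + s ^+ 2 * hdot x x.
  rewrite -subr_ge0; have := hdot_ge0 (B x - s *: x).
  by rewrite !hdotE s_conj -(hdot_conj (B x) x); congr (_ <= _); ring.
rewrite fmorph_div rmorphM /= -/s rmorph_nat.
have -> : (M + m)%:C%C / (2%:R * s) * hdot (P x) x =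
   2%:R^-1 * (s^-1 * ((M + m)%:C%C * hdot (P x) x)).
  by field; rewrite s_neq0.
rewrite ler_pM2l ?invr_gt0 ?ltr0n// ler_pdivlMl//.
exact: le_trans le_sqr le_cop.
Qed.

Lemma posop_zero_space A : (forall x, x = 0) -> posop A.
Proof. by move=> x0 x; rewrite [x]x0 (linear0r hdot). Qed.

Lemma reop_le_absop M m B : 0 < M * m -> accretive (Cop M m (absop B)) ->
  ople (reop B) (((M + m) / (2%:R * Num.sqrt (M * m)))%:C%C *: absop B).
Proof.
move=> Mm0 accB.
have [x0|[P0 normP BB] x] := accretive_absopP Mm0 accB.
  exact: posop_zero_space.
rewrite [X in _ <= X]hdotDl [X in _ + X]hdotNl [X in X + _]hdotZl subr_ge0.
by rewrite hdot_reop//; exact: re_hdot_le.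
Qed.

Lemma absop_unimodular a B : `|a| = 1 -> is_adjoint B (adjop B) ->
  absop (a *: B) = absop B.
Proof.
move=> a1 BB; rewrite /absop (adjop_adjoint (is_adjointZ a BB)).
rewrite (_ : (a^* *: adjop B) * (a *: B) = adjop B * B) //.
apply: bop_ext => x; change (a^* *: adjop B (a *: B x) = adjop B (B x)).
by rewrite linearZ scalerA mulrC -normCK a1 expr1n scale1r.
Qed.

Lemma imop_reop A : is_adjoint A (adjop A) -> imop A = reop ('i *: adjop A).
Proof.
move=> AA; rewrite /reop (adjop_adjoint (is_adjointZ 'i (is_adjoint_sym AA))).
rewrite conjCi scaleNr -scalerBr scalerA /imop -(opprB A) scalerN -scaleNr.
by rewrite invfM invCi -mulrN mulrC.
Qed.

Lemma imop_le_absop M m A : 0 < M * m ->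
  accretive (Cop M m (absop ('i *: adjop A))) ->
  ople (imop A) (((M + m) / (2%:R * Num.sqrt (M * m)))%:C%C *: absop (adjop A)).
Proof.
move=> Mm0 accA; have [AA|A0] := adjopP A.
  have absE : absop ('i *: adjop A) = absop (adjop A).
    apply: absop_unimodular; first exact: normCi.
    by rewrite (adjop_adjoint (is_adjoint_sym AA)); exact: is_adjoint_sym.
  by rewrite imop_reop // -absE; exact: reop_le_absop.
apply: posop_zero_space => x.
have [//|[P0 normP _]] := accretive_absopP Mm0 accA.
apply: accretive_Cop_inj Mm0 P0 accA _; apply: hdot_eq0.
by rewrite normP A0 scaler0 [LHS]linear0r.
Qed.

End Modulus.

Local Open Scope complex_scope.

Theorem theorem2p5 (R : realType) (M m : R) (H : hilbertType R) (A : bop H) :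
  0 < m -> m < M ->
  let K : R := (M + m) / (2%:R * Num.sqrt (M * m)) in
  [/\ accretive (Cop M m (absop A)) -> ople (reop A) (K%:C *: absop A),
      accretive (Cop M m (absop ('i *: adjop A))) ->
        ople (imop A) (K%:C *: absop (adjop A))
    & invertible_op A -> accretive (Cop M m (absop (invop A))) ->
        ople (reop (invop A)) (K%:C *: absop (invop A))].
Proof.
move=> m0 mM K; have Mm0 : 0 < M * m by rewrite mulr_gt0// (lt_trans m0).
split=> [||_]; [exact: reop_le_absop|exact: imop_le_absop|exact: reop_le_absop].
Qed.
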